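(* $(\mathbb{F}_2,\leq_2)$ is distributive: if $f$ is a function and $(g_i)_{i\in I}$ a set-indexed family of functions with $f\leq_2\lceil g_i\rceil_{i\in I}$, then there is a family of functions $(f_i)_{i\in I}$ with $f_i\leq_2 g_i$ for all $i\in I$ and $f\equiv_2\lceil f_i\rceil_{i\in I}$.
   Context: All functions are between topological spaces. A partial function $F:\subseteq X\to Y$ is continuous if continuous on $\operatorname{dom}(F)$ with the subspace topology. For functions $f:\underline{X}_1\to\underline{Y}_1$, $g:\underline{X}_2\to\underline{Y}_2$, $f\leq_2 g$ means there are continuous partial functions $F:\subseteq\underline{X}_1\times\underline{Y}_2\to\underline{Y}_1$ and $G:\subseteq\underline{X}_1\to\underline{X}_2$ with $f(x)=F(x,g(G(x)))$ (all defined) for all $x\in X_1$; $\equiv_2$ is the induced equivalence and $\mathbb{F}_2$ the class of equivalence classes. The coproduct $\coprod_{i\in I}\underline{X}_i$ is $\bigcup_i\{i\}\times X_i$ with the smallest topology containing all $\{i\}\times U$, $U$ open in $\underline{X}_i$; for $g_i:\underline{X}_i\to\underline{Y}_i$, $\lceil g_i\rceil_{i\in I}(i,x)=(i,g_i(x))$ defines $\lceil g_i\rceil_{i\in I}:\coprod_i\underline{X}_i\to\coprod_i\underline{Y}_i$. It is known that $\lceil g_i\rceil_{i\in I}$ is the supremum of the $g_i$ in $(\mathbb{F}_2,\leq_2)$. A complete join-semilattice is called distributive iff $x\leq\sup_{i\in I}y_i$ implies the existence of $(x_i)_{i\in I}$ with $x_i\leq y_i$ for all $i$ and $x=\sup_{i\in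 I}x_i$. *)

(* Defs.v *)
From HB Require Import structures.
From mathcomp Require Import all_boot all_order all_algebra.
From mathcomp Require Import all_classical topology.

Set Implicit Arguments.
Unset Strict Implicit.
Unset Printing Implicit Defensive.

Local Open Scope classical_set_scope.

(* The domain is a subtype carrying the subspace topology (set_type with the
   initial topology of set_val), so that partial functions into an empty space
   also exist; a total function on X together with a domain would miss them. *)
Record pcontinuous_fun (X Y : topologicalType) := PContinuousFun {
  pdom : set X;
  pval : pdom -> Y;
  pval_continuous : continuous pval
}.

Definition pmaps (X Y : topologicalType) (F : pcontinuous_fun X Y)
    (x : X) (y : Y) : Prop :=
  exists u : pdom F, set_val u = x /\ pval u = y.

(* The two pmaps conditions together say that x is in dom G, that
   (x, g (G x)) is in dom F, and that F (x, g (G x)) = f x. *)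
Definition le2 (X1 Y1 X2 Y2 : topologicalType)
    (f : X1 -> Y1) (g : X2 -> Y2) : Prop :=
  exists (F : pcontinuous_fun (X1 * Y2)%type Y1) (G : pcontinuous_fun X1 X2),
    forall x : X1, exists x2 : X2,
      pmaps G x x2 /\ pmaps F (x, g x2) (f x).

Definition equiv2 (X1 Y1 X2 Y2 : topologicalType)
    (f : X1 -> Y1) (g : X2 -> Y2) : Prop :=
  le2 f g /\ le2 g f.

(* Coproduct spaces are {i : I & X i} with the library's topology, whose open
   sets are the U with every preimage under existT X i open (sigT_openP),
   i.e. the unions of sets {i} x V with V open in X i. *)
Definition coprod_fun (I : choiceType) (X Y : I -> topologicalType)
    (g : forall i, X i -> Y i) (u : {i : I & X i}) : {i : I & Y i} :=
  existT (fun i => Y i) (projT1 u) (g (projT1 u) (projT2 u)).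

(* Main.v *)
Require Import Defs.
From HB Require Import structures.
From mathcomp Require Import all_boot all_order all_algebra.
From mathcomp Require Import all_classical topology.

(** A reduction of [f] to the coproduct of the [g i] has a total continuous
    inner map [G : X -> {i & A i}]. The fibres of [projT1 \o G] are open and
    partition [X], so [X] is homeomorphic to their coproduct. Restricting [f]
    to the fibres gives the required family: the [i]-th restriction reduces to
    [g i] because there [G] takes its values in the [i]-th summand. *)

Set Implicit Arguments.
Unset Strict Implicit.
Unset Printing Implicit Defensive.

Local Open Scope classical_set_scope.

Lemma set_val_continuous (X : topologicalType) (D : set X) :
  continuous (set_val : D -> X).
Proof. exact: (@initial_continuous D X set_val). Qed.

Lemma continuous_into_subtype (X Z : topologicalType) (D : set X) (h : Z -> D) :
  continuous (set_val \o h) -> continuous h.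
Proof. exact: (@continuous_comp_initial D Z X set_val h). Qed.

Lemma continuous_pair (X Y Z : topologicalType) (h : Z -> X) (k : Z -> Y) :
  continuous h -> continuous k -> continuous (fun z => (h z, k z)).
Proof. by move=> ch ck z; apply: cvg_pair; [exact: ch|exact: ck]. Qed.

Lemma fst_continuous (X Y : topologicalType) : continuous (@fst X Y).
Proof. by move=> z; exact: cvg_fst. Qed.

Lemma snd_continuous (X Y : topologicalType) : continuous (@snd X Y).
Proof. by move=> z; exact: cvg_snd. Qed.

(** Each injection [existT A i] is open and injective: a neighbourhood of [h z] has an image that is
    a neighbourhood in the coproduct, and injectivity brings membership back. *)
Lemma continuous_existT_comp (I : choiceType) (A : I -> topologicalType)
    (Z : topologicalType) (i : I) (h : Z -> A i) :
  continuous (existT A i \o h) -> continuous h.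
Proof.
move=> ch z V nV; have := ch z _ (existT_nbhs _ _ _ nV).
apply: (@filterS _ (nbhs z)) => w [a Va /= /eqP].
by rewrite eq_Tagged /= => /eqP <-.
Qed.

Lemma projT2_continuous (I : choiceType) (Y : topologicalType) :
  continuous (fun u : {_ : I & Y} => projT2 u).
Proof. by move=> [i y]. Qed.

Lemma pmaps_fun (X Y : topologicalType) (F : pcontinuous_fun X Y) x y y' :
  pmaps F x y -> pmaps F x y' -> y = y'.
Proof. by move=> [u [<- <-]] [v [/val_inj -> <-]]. Qed.

Section total.
Variables (X Y : topologicalType) (h : X -> Y) (ch : continuous h).

Lemma comp_set_val_continuous (D : set X) : continuous (h \o set_val : D -> Y).
Proof.
by move=> u; apply: continuous_comp; [exact: set_val_continuous|exact: ch].
Qed.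

Definition total_pcontinuous := PContinuousFun (@comp_set_val_continuous setT).

Lemma pmaps_total x : pmaps total_pcontinuous x (h x).
Proof. by exists (exist _ x (mem_set I)). Qed.

End total.

Section pcomp.
Variables (X Y Z : topologicalType) (F : pcontinuous_fun X Y).
Variables (h : Z -> X) (ch : continuous h).

Definition pcomp_arg (u : h @^-1` pdom F) : pdom F :=
  exist _ (h (set_val u)) (mem_set (set_valP u)).

Lemma pcomp_arg_continuous : continuous pcomp_arg.
Proof. by apply: continuous_into_subtype; exact: comp_set_val_continuous. Qed.

Lemma pcomp_continuous : continuous (@pval _ _ F \o pcomp_arg).
Proof.
move=> u; apply: continuous_comp; first exact: pcomp_arg_continuous.
exact: pval_continuous.
Qed.

(** Serves to feed rearranged arguments to the outer map of a reduction, which may be genuinely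
    partial. *)
Definition pcomp := PContinuousFun pcomp_continuous.

Lemma pmaps_comp z y : pmaps F (h z) y -> pmaps pcomp z y.
Proof.
move=> [u [uE <-]].
have Dz : (h @^-1` pdom F) z by rewrite /preimage /= -uE; exact: set_valP.
exists (exist _ z (mem_set Dz)); split => //=.
by congr pval; exact/val_inj.
Qed.

End pcomp.

(** The reduction condition puts every [x] in the domain of the inner map, so that map may be taken
    total; the outer one stays partial. *)
Lemma le2P (X1 Y1 X2 Y2 : topologicalType) (f : X1 -> Y1) (g : X2 -> Y2) :
  le2 f g <-> exists (F : pcontinuous_fun (X1 * Y2)%type Y1) (G : X1 -> X2),
    continuous G /\ forall x, pmaps F (x, g (G x)) (f x).
Proof.
split=> [[F [G FG]]|[F [G [cG FG]]]]; last first.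
  exists F, (total_pcontinuous cG) => x; exists (G x).
  by split; [exact: pmaps_total|exact: FG].
have domG x : x \in pdom G.
  by have [_ [[u [<- _]] _]] := FG x; exact/mem_set/set_valP.
pose u x : pdom G := exist _ x (domG x).
exists F, (fun x => pval (u x)); split=> x.
  apply: (@continuous_comp _ _ _ u (@pval _ _ G)); last exact: pval_continuous.
  by apply: continuous_into_subtype => z; exact: cvg_id.
have [x2 [Gx Fx]] := FG x.
by rewrite (_ : pval (u x) = x2) //; apply: pmaps_fun Gx; exists (u x).
Qed.

Lemma le2_total (X1 Y1 X2 Y2 : topologicalType) (f : X1 -> Y1) (g : X2 -> Y2)
    (F : X1 * Y2 -> Y1) (G : X1 -> X2) :
  continuous F -> continuous G -> (forall x, f x = F (x, g (G x))) -> le2 f g.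
Proof.
move=> cF cG FG; apply/le2P; exists (total_pcontinuous cF), G; split=> // x.
by rewrite FG; exact: pmaps_total.
Qed.

Section fibre_decomposition.
Variables (X : topologicalType) (I : choiceType) (A : I -> topologicalType).
Variables (G : X -> {i : I & A i}) (cG : continuous G).

Definition fibre (i : I) : set X := [set x | projT1 (G x) = i].

Lemma fibre_open i : open (fibre i).
Proof.
have -> : fibre i = G @^-1` (existT A i @` setT).
  apply/seteqP; split=> x; last by move=> [a _ /= GE]; rewrite /fibre /= -GE.
  by rewrite /fibre /= => <-; exists (projT2 (G x)) => //; case: (G x).
by move/continuousP: cG; apply; exact/existT_open_map/openT.
Qed.

Definition fibre_incl (u : {i : I & fibre i}) : X := set_val (projT2 u).

Lemma fibre_incl_continuous : continuous fibre_incl.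
Proof.
by move=> [i x] U nU; exact: set_val_continuous nU.
Qed.

(** The inverse of [fibre_incl]. *)
Definition to_fibre (x : X) : {i : I & fibre i} :=
  existT (fun i => fibre i : Type) (projT1 (G x))
    (exist _ x (mem_set (erefl (projT1 (G x)) : fibre (projT1 (G x)) x))).

Lemma to_fibreE i (x : fibre i) :
  to_fibre (set_val x) = existT (fun i => fibre i : Type) i x.
Proof.
case: x => x xi; have Gx : projT1 (G x) = i by exact: set_mem xi.
(* Eliminating [Gx] replaces [i] by [projT1 (G x)], so no transport between fibres is needed. *)
case: i / Gx xi => xi; rewrite /to_fibre /=; congr existT; exact: val_inj.
Qed.

Lemma to_fibre_continuous : continuous to_fibre.
Proof.
move=> x U [_ [/= [W oW <-] Wx WU]].
(* [W] is open in [X] and its trace on the fibre of [x] lands in [U]. Cutting [W] down to this open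
   fibre keeps the index constant near [x]. *)
have nW : nbhs x (W `&` fibre (projT1 (G x))).
  by apply: open_nbhs_nbhs; split=> //; exact: openI oW (fibre_open _).
apply: filterS nW => y [Wy Fy].
by have := WU (exist _ y (mem_set Fy)) Wy; rewrite /= -to_fibreE.
Qed.

(** A sigma type, so that [fibre_proj] can extract the component at index [i] without a cast in its
    definition. *)
Lemma fibre_component i (x : fibre i) :
  {a : A i | existT A i a = G (set_val x)}.
Proof.
case: x => x xi; have Gx : projT1 (G x) = i by exact: set_mem xi.
by case: i / Gx xi => xi; exists (projT2 (G x)) => /=; case: (G x).
Qed.

Definition fibre_proj i (x : fibre i) : A i := sval (fibre_component x).

Lemma fibre_projE i (x : fibre i) : existT A i (fibre_proj x) = G (set_val x).
Proof. exact: svalP (fibre_component x). Qed.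

Lemma fibre_proj_continuous i : continuous (@fibre_proj i).
Proof.
apply: continuous_existT_comp.
rewrite (_ : _ \o _ = G \o set_val); last exact/funext/fibre_projE.
exact: comp_set_val_continuous.
Qed.

End fibre_decomposition.

Theorem theorem4p21 (X Y : topologicalType) (f : X -> Y)
    (I : choiceType) (A B : I -> topologicalType)
    (g : forall i : I, A i -> B i) :
  le2 f (coprod_fun g) ->
  exists (X' Y' : I -> topologicalType) (f' : forall i : I, X' i -> Y' i),
    (forall i : I, le2 (f' i) (g i)) /\ equiv2 f (coprod_fun f').
Proof.
move=> /le2P [F [G [cG FG]]].
exists (fun i => fibre G i : topologicalType), (fun=> Y).
exists (fun i x => f (set_val x)).
split=> [i|].
  (* Tagging the answer of [g i] with [i] turns it into an answer of the coproduct, which [F] can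
     process. *)
  pose h (z : fibre G i * B i) := (set_val z.1, existT B i z.2).
  have ch : continuous h.
    apply: continuous_pair => z; apply: continuous_comp.
    - exact: fst_continuous.
    - exact: set_val_continuous.
    - exact: snd_continuous.
    - exact: existT_continuous.
  apply/le2P; exists (pcomp F ch), (@fibre_proj _ _ _ G i).
  split=> [|x]; first exact: fibre_proj_continuous.
  apply: pmaps_comp; rewrite /h /=.
  (* With [G (set_val x)] in the form [existT A i _], [coprod_fun g] computes to [g i] tagged with
     [i]. *)
  have := FG (set_val x); rewrite -fibre_projE; exact.
split.
  (* The value of [f] is the answer of the coproduct with its tag dropped. *)
  apply: (@le2_total _ _ _ _ _ _
    (fun z : X * {_ : I & Y} => projT2 z.2) (to_fibre G)) => //.
  - move=> z; apply: (@continuous_comp _ _ _ snd); first exact: snd_continuous.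
    exact: projT2_continuous.
  - exact: to_fibre_continuous.
(* Conversely [f] returns the value without its tag, and the outer map restores the tag from the
   original input. This is continuous because the tag is locally constant. *)
apply: (@le2_total _ _ _ _ _ _
  (fun z : {i : I & fibre G i} * Y => existT (fun=> Y : Type) (projT1 z.1) z.2)
  (@fibre_incl _ _ _ G)) => //.
  move=> [[i x] y] U /= nU.
  (* [nU] is convertible to [nbhs y (existT _ i @^-1` U)]. *)
  exists (existT (fun i => fibre G i : Type) i @` setT,
          existT (fun=> Y : Type) i @^-1` U).
    by split=> //=; apply: existT_nbhs; exact: filterT.
  by move=> [_ y'] [/= [x' _ <-]].
exact: fibre_incl_continuous.
Qed.
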